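(* Let $M$ be a spacelike translation surface in $\mathbb{L}^3$ parametrized by $X(s,t)=\alpha(s)+\beta(t)$ such that $\alpha''$ is spacelike and $\beta$ is a pseudo-null curve. If $M$ is a maximal surface, then $M$ is a plane or both curves $\alpha,\beta$ are planar curves. In the latter case, after a rigid motion, the surface can be parametrized by $$X(x,t)=(x,f(x),0)+\beta(t),$$ where $f$ is a smooth function satisfying $$f'(x)=-\tan\big(k(\cos\theta\, f(x)-x\sin\theta)+a\big),$$ and $$\beta(t)=m e^{kt}(-\sin\theta,\cos\theta,1)+t(\cos\theta,\sin\theta,0),$$ with $a,k,m,\theta\in\mathbb{R}$ and $k,m\neq0$.
   Context: $\mathbb{L}^3$ is $\mathbb{R}^3$ with the metric $\langle\cdot,\cdot\rangle=dx^2+dy^2-dz^2$. A vector $v$ is spacelike if $\langle v,v\rangle>0$ or $v=0$, timelike if $\langle v,v\rangle<0$, lightlike if $\langle v,v\rangle=0$ and $v\ne0$. A rigid motion is an affine isometry of $\mathbb{L}^3$. A translation surface is parametrized by $X(s,t)=\alpha(s)+\beta(t)$ with $\alpha:I\to\mathbb{L}^3$, $\beta:J\to\mathbb{L}^3$ smooth curves (the generating curves) and $\alpha'(s),\beta'(t)$ linearly independent for all $s,t$. A surface is spacelike if its induced metric is Riemannian, and maximal if it is spacelike with mean curvature $H=0$ everywhere; for generating curves parametrized by arc length, $H=0$ reads $\det(\alpha',\beta',\alpha'')+\det(\alpha',\beta',\beta'')=0$. A pseudo-null curve is a spacelike curve parametrized by arc length whose second derivative is everywhere lightlike (and nonzero).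 Planar means contained in an affine plane. Standing conventions: generating curves are spacelike, parametrized by arc length, with nowhere vanishing second derivative; results are local (''is a plane'' means contained in a plane), and the causal character of the derivatives of each curve is the same at all parameter values. *)

(* Defs.v *)
From HB Require Import structures.
From mathcomp Require Import all_boot all_order all_algebra.
From mathcomp Require Import all_classical all_reals all_analysis.
Set Implicit Arguments.
Unset Strict Implicit.
Unset Printing Implicit Defensive.
Import Order.TTheory GRing.Theory Num.Theory.
Import numFieldNormedType.Exports.
Local Open Scope classical_set_scope.
Local Open Scope ring_scope.

(* Points and vectors of L^3 are row vectors 'rV[R]_3; the coordinates x, y, z
   are the columns 0, 1, 2. *)

Definition vec3 (R : realType) (a b c : R) : 'rV[R]_3 :=
  \row_(i < 3) [:: a; b; c]`_i.

Definition lorentz (R : realType) (u v : 'rV[R]_3) : R :=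
  u 0 0 * v 0 0 + u 0 1 * v 0 1 - u 0 2 * v 0 2.

Definition spacelike (R : realType) (v : 'rV[R]_3) : Prop :=
  0 < lorentz v v \/ v = 0.

Definition lightlike (R : realType) (v : 'rV[R]_3) : Prop :=
  lorentz v v = 0 /\ v <> 0.

Definition rigid_motion (R : realType) (Phi : 'rV[R]_3 -> 'rV[R]_3) : Prop :=
  exists (A : 'M[R]_3) (b : 'rV[R]_3),
    (forall v w, lorentz (v *m A) (w *m A) = lorentz v w) /\
    (forall p, Phi p = p *m A + b).

(* The vector with lorentz (lcross u v) w = det (u, v, w) for all w. *)
Definition lcross (R : realType) (u v : 'rV[R]_3) : 'rV[R]_3 :=
  vec3 (u 0 1 * v 0 2 - u 0 2 * v 0 1)
       (u 0 2 * v 0 0 - u 0 0 * v 0 2)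
       (u 0 1 * v 0 0 - u 0 0 * v 0 1).

Definition affine_plane (R : realType) (P : set 'rV[R]_3) : Prop :=
  exists p e1 e2 : 'rV[R]_3, free [:: e1; e2] /\
    P = [set q | exists a b : R, q = p + a *: e1 + b *: e2].

Definition planar (R : realType) (A : set 'rV[R]_3) : Prop :=
  exists P : set 'rV[R]_3, affine_plane P /\ A `<=` P.

Definition open_interval (R : realType) (I : set R) : Prop :=
  [/\ open I, is_interval I & I !=set0].

Definition smooth_on (R : realType) (V : normedModType R) (I : set R)
    (f : R -> V) : Prop :=
  forall (n : nat) (s : R), I s -> derivable (derive1n n f) s 1.

(* A smooth change of parameter from the open interval I onto K; since x'
   does not vanish, the inverse is smooth too. *)
Definition reparametrization (R : realType) (I K : set R) (x : R -> R) : Prop :=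
  [/\ smooth_on I x, (forall s, I s -> derive1 x s != 0) & set_bij I K x].

Definition spacelike_curve (R : realType) (I : set R) (c : R -> 'rV[R]_3)
    : Prop :=
  forall s, I s -> spacelike (derive1 c s).

Definition arc_length (R : realType) (I : set R) (c : R -> 'rV[R]_3) : Prop :=
  forall s, I s -> `|lorentz (derive1 c s) (derive1 c s)| = 1.

Definition pseudo_null (R : realType) (J : set R) (c : R -> 'rV[R]_3) : Prop :=
  [/\ spacelike_curve J c, arc_length J c &
      forall t, J t -> lightlike (derive1n 2 c t)].

Definition translation_map (R : realType) (alpha beta : R -> 'rV[R]_3)
    (s t : R) : 'rV[R]_3 := alpha s + beta t.

Definition translation_surface (R : realType) (I J : set R)
    (alpha beta : R -> 'rV[R]_3) : Prop :=
  [/\ smooth_on I alpha, smooth_on J beta &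
      forall s t, I s -> J t -> free [:: derive1 alpha s; derive1 beta t]].

Section ParametrizedSurface.
Variables (R : realType) (X : R -> R -> 'rV[R]_3).

Definition X_s (s t : R) : 'rV[R]_3 := derive1 (X^~ t) s.
Definition X_t (s t : R) : 'rV[R]_3 := derive1 (X s) t.
Definition X_ss (s t : R) : 'rV[R]_3 := derive1 (X_s^~ t) s.
Definition X_st (s t : R) : 'rV[R]_3 := derive1 (X_s s) t.
Definition X_tt (s t : R) : 'rV[R]_3 := derive1 (X_t s) t.

Definition coefE (s t : R) : R := lorentz (X_s s t) (X_s s t).
Definition coefF (s t : R) : R := lorentz (X_s s t) (X_t s t).
Definition coefG (s t : R) : R := lorentz (X_t s t) (X_t s t).

Definition spacelike_surface (I J : set R) : Prop :=
  forall s t, I s -> J t -> forall a b : R, (a, b) <> (0, 0) ->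
    0 < a ^+ 2 * coefE s t + 2 * a * b * coefF s t + b ^+ 2 * coefG s t.

(* On a spacelike surface the normal is timelike, so that it is normalized to
   lorentz N N = -1. *)
Definition unit_normal (s t : R) : 'rV[R]_3 :=
  let w := lcross (X_s s t) (X_t s t) in
  (Num.sqrt (- lorentz w w))^-1 *: w.

(* Half the trace of the second fundamental form, with the factor
   lorentz N N = -1; meaningful for a spacelike surface. *)
Definition mean_curvature (s t : R) : R :=
  let N := unit_normal s t in
  let e := lorentz N (X_ss s t) in
  let f := lorentz N (X_st s t) in
  let g := lorentz N (X_tt s t) in
  - ((e * coefG s t - 2 * f * coefF s t + g * coefE s t) /
     (2 * (coefE s t * coefG s t - coefF s t ^+ 2))).

Definition maximal_surface (I J : set R) : Prop :=
  spacelike_surface I J /\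
  forall s t, I s -> J t -> mean_curvature s t = 0.

End ParametrizedSurface.

Definition exp_curve (R : realType) (k m theta t : R) : 'rV[R]_3 :=
  (m * expR (k * t)) *: vec3 (- sin theta) (cos theta) 1 +
  t *: vec3 (cos theta) (sin theta) 0.

(* Main.v *)
Require Import Defs.
From HB Require Import structures.
From mathcomp Require Import all_boot all_order all_algebra.
From mathcomp Require Import all_classical all_reals all_analysis.
From mathcomp Require Import ring lra.
Import Order.TTheory GRing.Theory Num.Theory.
Import numFieldNormedType.Exports.
Local Open Scope classical_set_scope.
Local Open Scope ring_scope.

(** A pseudo-null curve has [beta'' = phi n] with a constant lightlike [n]:
    the derivative of [beta''] is orthogonal to [beta'] and to [beta''], and
    inside the Lorentzian plane orthogonal to [beta'] the only vectors
    orthogonal to a lightlike one are its multiples.  Hence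
    [beta' = b + Phi n] with [Phi' = phi] and a constant unit vector [b]
    orthogonal to [n] ([lightlike_acceleration]).

    Write [h], [C] for the products of [alpha'] with [b], [n], and [j], [D] for
    those of [alpha''].  A spacelike surface forces [C <> 0]
    ([spacelike_transversal]).  Multiplying the equation [H = 0] by
    [det (alpha', b, n)], which is [C] up to sign, turns every determinant into
    a Gram determinant, and the equation becomes
    [D (1 - h^2) + C h j + Phi C (C j - h D) = phi C^2]
    ([maximal_identity]).  At a fixed [s] this is a linear equation
    [phi = p + k Phi] with constant coefficients; [k <> 0] because
    [(C j - h D)^2 = D^2 + C^2 <alpha'', alpha''>] and [alpha''] is
    spacelike.  Absorbing [p / k] into [b] gives
    [beta' = b + c e^(kt) n].  As the exponential takes two values, the
    equation splits, at every [s], into [D (1 - h^2) + C h j = 0] and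
    [C j - h D = k C] ([exponential_form]).

    The first of these says that [(alpha' - h b) / C] has zero derivative, so
    it is a constant vector [M] and [alpha] is planar; both together give
    [<alpha'', alpha''> = k^2 (1 - h^2)], so the plane of [b] and [M] is
    spacelike.  Normalizing [M] to [e1] and putting [e2 = - b], there is an
    orthonormal frame in which [n] is a multiple of [e1 + e3]
    ([adapted_frame]).  In that frame [theta = - pi / 2], and with
    [alpha' = u e1 + v e2] the second equation is [u v' - v u' = - k u].
    Since [u^2 + v^2 = 1], it integrates to
    [atan (v / u) = - (k x + a)] where [x' = u], which is the differential
    equation of [f] ([profile_of_angle_ode]).

    Both curves are therefore planar in every case. *)

(** * Lorentzian linear algebra *)

Section LorentzAlgebra.
Context {R : realType}.
Implicit Types (u v w b n y : 'rV[R]_3) (c : R).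

Lemma vec3E (x0 x1 x2 : R) :
  ((vec3 x0 x1 x2 0 0 = x0) * (vec3 x0 x1 x2 0 1 = x1) *
   (vec3 x0 x1 x2 0 2 = x2))%type.
Proof. by rewrite /vec3 !mxE. Qed.

Lemma rowP3 u v :
  u 0 0 = v 0 0 -> u 0 1 = v 0 1 -> u 0 2 = v 0 2 -> u = v.
Proof.
move=> e0 e1 e2; apply/rowP => -[[|[|[|//]]] i].
- by have -> : Ordinal i = 0 by exact/val_inj.
- by have -> : Ordinal i = 1 by exact/val_inj.
- by have -> : Ordinal i = 2 by exact/val_inj.
Qed.

Lemma lorentzC u v : lorentz u v = lorentz v u.
Proof. by rewrite /lorentz; ring. Qed.

Lemma lorentzDl u v w : lorentz (u + v) w = lorentz u w + lorentz v w.
Proof. by rewrite /lorentz !mxE; ring. Qed.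

Lemma lorentzZl c u w : lorentz (c *: u) w = c * lorentz u w.
Proof. by rewrite /lorentz !mxE; ring. Qed.

Lemma lorentzNl u w : lorentz (- u) w = - lorentz u w.
Proof. by rewrite /lorentz !mxE; ring. Qed.

Lemma lorentzDr u v w : lorentz w (u + v) = lorentz w u + lorentz w v.
Proof. by rewrite ![lorentz w _]lorentzC lorentzDl. Qed.

Lemma lorentzZr c u w : lorentz w (c *: u) = c * lorentz w u.
Proof. by rewrite ![lorentz w _]lorentzC lorentzZl. Qed.

Lemma lorentzNr u w : lorentz w (- u) = - lorentz w u.
Proof. by rewrite ![lorentz w _]lorentzC lorentzNl. Qed.

Definition lorentzE :=
  (lorentzDl, lorentzDr, lorentzNl, lorentzNr, lorentzZl, lorentzZr).

(** Since [lorentz (lcross u v) w] is a determinant, this is the product rule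
    for determinants; the sign is the determinant of the metric. *)
Lemma det_mul_gram u v w x y z :
  lorentz (lcross u v) w * lorentz (lcross x y) z =
  - (lorentz u x * (lorentz v y * lorentz w z - lorentz v z * lorentz w y)
   - lorentz u y * (lorentz v x * lorentz w z - lorentz v z * lorentz w x)
   + lorentz u z * (lorentz v x * lorentz w y - lorentz v y * lorentz w x)).
Proof. by rewrite /lorentz /lcross !vec3E; ring. Qed.

Lemma lcross_gram u v :
  - lorentz (lcross u v) (lcross u v) =
  lorentz u u * lorentz v v - lorentz u v ^+ 2.
Proof. by rewrite /lorentz /lcross !vec3E; ring. Qed.

Lemma lorentz_basis_eq0 u v w y : lorentz (lcross u v) w != 0 ->
  lorentz y u = 0 -> lorentz y v = 0 -> lorentz y w = 0 -> y = 0.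
Proof.
move=> d0 yu yv yw.
have y0 i : lorentz (lcross u v) w * y 0 i =
    lorentz y u * (lcross v w) 0 i + lorentz y v * (lcross w u) 0 i
    + lorentz y w * (lcross u v) 0 i.
  case: i => -[|[|[|//]]] i.
  - have -> : Ordinal i = 0 by exact/val_inj.
    by rewrite /lorentz /lcross !vec3E; ring.
  - have -> : Ordinal i = 1 by exact/val_inj.
    by rewrite /lorentz /lcross !vec3E; ring.
  - have -> : Ordinal i = 2 by exact/val_inj.
    by rewrite /lorentz /lcross !vec3E; ring.
apply/rowP => i; rewrite mxE; apply: (mulfI d0).
by rewrite y0 yu yv yw !mul0r mulr0 !addr0.
Qed.

Lemma lightlike_third u : lightlike u -> u 0 2 != 0.
Proof.
move=> [uu u0]; apply/eqP => u2; apply: u0.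
move: uu; rewrite /lorentz u2 => uu.
have /eqP : u 0 0 ^+ 2 + u 0 1 ^+ 2 = 0 by lra.
rewrite paddr_eq0 ?sqr_ge0// !sqrf_eq0 => /andP[/eqP u00 /eqP u01].
by apply: rowP3; rewrite mxE.
Qed.

(** The orthogonal complement of a unit spacelike [b] is a Lorentzian plane,
    where the orthogonal of a lightlike vector is its own line.  The Gram
    identity shows that [det (x, y, n)] vanishes for every [x], that is,
    [y] and [n] are collinear; the ratio is read off on the third
    coordinate, which cannot vanish for a lightlike [n]. *)
Lemma orth_lightlike_collinear b n y :
  lorentz b b = 1 -> lorentz n n = 0 -> lorentz b n = 0 -> n 0 2 != 0 ->
  lorentz y b = 0 -> lorentz y n = 0 -> y = (y 0 2 / n 0 2) *: n.
Proof.
move=> bb nn bn n2 yb yn.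
have d0 x : lorentz (lcross x y) n = 0.
  (* Any vector not orthogonal to [n] would do. *)
  pose z := vec3 0 0 1 : 'rV[R]_3.
  have zn : lorentz z n != 0.
    by rewrite /lorentz !vec3E !mul0r !add0r mul1r oppr_eq0.
  have := det_mul_gram x y n z b n.
  rewrite (lorentzC n b) bn nn yb yn => /eqP.
  rewrite !(mulr0, mul0r, subr0, subrr, addr0, oppr0) mulf_eq0 => /orP[/eqP//|].
  have := det_mul_gram z b n z b n.
  rewrite (lorentzC n b) bn bb nn => e /eqP d0.
  by exfalso; move: e; rewrite d0; move: zn; rewrite (lorentzC n z) => /eqP; nra.
apply: rowP3; rewrite !mxE; apply: (mulIf n2).
- rewrite mulrAC divfK//.
  by have := d0 (vec3 0 1 0); rewrite /lorentz /lcross !vec3E; lra.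
- rewrite mulrAC divfK//.
  by have := d0 (vec3 1 0 0); rewrite /lorentz /lcross !vec3E; lra.
- by rewrite mulrAC divfK.
Qed.

Section Frame.
Variables (a a2 b n : 'rV[R]_3).
Hypotheses (aa : lorentz a a = 1) (aa2 : lorentz a2 a = 0).
Hypotheses (bb : lorentz b b = 1) (bn : lorentz b n = 0).
Hypothesis (nn : lorentz n n = 0).

Let h := lorentz a b.
Let C := lorentz a n.
Let j := lorentz a2 b.
Let D := lorentz a2 n.
Let g := lorentz a2 a2.

(** The hypothesis is the equation [H = 0] with [beta' = b + p n] and
    [beta'' = q n].  Multiplying it by [det (a, b, n)] replaces the unknown
    orientation of [(a, b, n)] by inner products. *)
Lemma maximal_identity p q :
  lorentz (lcross a (b + p *: n)) (a2 + q *: n) = 0 ->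
  D * (1 - h ^+ 2) + C * h * j + p * (C * (C * j - h * D)) = q * C ^+ 2.
Proof.
move=> H; have := det_mul_gram a (b + p *: n) (a2 + q *: n) a b n.
rewrite H mul0r !lorentzE aa aa2 bb bn nn.
rewrite (lorentzC b a) (lorentzC n a) (lorentzC n b) bn -/h -/C -/j -/D.
lra.
Qed.

(** Up to sign, [C j - h D] is [det (a, n, a2)], because
    [det (a, b, n) = C] up to sign; its square is then a Gram determinant. *)
Lemma sqr_slope : C != 0 -> (C * j - h * D) ^+ 2 = D ^+ 2 + C ^+ 2 * g.
Proof.
move=> C0.
have := det_mul_gram a b n a b n; have := det_mul_gram a n a2 a b n.
have := det_mul_gram a n a2 a n a2.
rewrite aa aa2 bb bn nn (lorentzC b a) (lorentzC n a) (lorentzC n b).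
rewrite (lorentzC n a2) (lorentzC a a2) aa2 bn -/h -/C -/j -/D -/g.
set d1 := lorentz _ a2; set d2 := lorentz _ n => e1 e2 e3.
have C20 : C ^+ 2 != 0 by rewrite expf_neq0.
have e4 : (d1 * d2) ^+ 2 = (d1 * d1) * (d2 * d2) by ring.
rewrite e2 e1 e3 in e4.
by apply: (mulfI C20); lra.
Qed.

Lemma frame_basis : C != 0 -> lorentz (lcross a b) n != 0.
Proof.
move=> C0; have := det_mul_gram a b n a b n.
rewrite aa bb bn nn (lorentzC b a) (lorentzC n a) (lorentzC n b) bn -/h -/C.
move=> e; apply/eqP => d0; move: e; rewrite d0.
have : C * C != 0 by rewrite mulf_neq0.
by move=> /eqP; lra.
Qed.

(** The two equations are linear in [D] and [j]; the value of [g] follows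
    from [sqr_slope]. *)
Lemma solve_frame k : C != 0 ->
  D * (1 - h ^+ 2) + C * h * j = 0 -> C * j - h * D = k * C ->
  [/\ D = - (h * k * C), j = k * (1 - h ^+ 2) & g = k ^+ 2 * (1 - h ^+ 2)].
Proof.
move=> C0 e1 e2.
have D1 : D = - (h * k * C).
  rewrite (_ : D = D * (1 - h ^+ 2) + C * h * j - h * (C * j - h * D)).
    by rewrite e1 e2; ring.
  by ring.
have j1 : j = k * (1 - h ^+ 2).
  by apply: (mulfI C0); move: e2; rewrite D1; lra.
split=> //.
have C20 : C ^+ 2 != 0 by rewrite expf_neq0.
have := sqr_slope C0; rewrite e2 D1 => e3.
by apply: (mulfI C20); lra.
Qed.

(** The difference of the two sides is orthogonal to the basis [a, b, n]:
    to [b] and [n] identically, and to [a] by the hypothesis.  This is the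
    statement that [(a - h b) / C] has zero derivative when [a' = a2]. *)
Lemma frame_const : C != 0 -> D * (1 - h ^+ 2) + C * h * j = 0 ->
  C *: (a2 - j *: b) = D *: (a - h *: b).
Proof.
move=> C0 e; apply/eqP; rewrite -subr_eq0; apply/eqP.
apply: (lorentz_basis_eq0 _ _ _ _ (frame_basis C0)); rewrite !lorentzE.
- by rewrite aa aa2 (lorentzC b a) -/h; lra.
- by rewrite bb -/h -/j; lra.
- by rewrite bn -/C -/D; lra.
Qed.

End Frame.
End LorentzAlgebra.

(** * Calculus on an interval *)

Section Calculus.
Context {R : realType}.
Implicit Types (I J K : set R).

Lemma is_derive_continuous {f : R -> R} {s df : R} :
  is_derive s 1 f df -> {for s, continuous f}.
Proof. by move=> ?; apply/differentiable_continuous/derivable1_diffP. Qed.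

Lemma is_derive_div {f g : R -> R} {s df dg : R} :
  is_derive s 1 f df -> is_derive s 1 g dg -> g s != 0 ->
  is_derive s 1 (fun t => f t / g t) ((df * g s - f s * dg) / g s ^+ 2).
Proof.
move=> f' g' g0; have gV := is_deriveV g0 g'.
have := is_deriveM f' gV.
move/is_derive_eq; apply; rewrite /GRing.scale /=; field.
exact: g0.
Qed.

Lemma derive1_eq_on {V : normedModType R} {I} {f g : R -> V} {s} :
  open I -> I s -> (forall t, I t -> f t = g t) -> derive1 f s = derive1 g s.
Proof.
move=> oI Is fg; rewrite !derive1E; apply: near_eq_derive.
by have := open_nbhs_nbhs (conj oI Is); apply: filterS.
Qed.

Lemma derivable_eq_on {V : normedModType R} {I} {f g : R -> V} {s} :
  open I -> I s -> (forall t, I t -> f t = g t) -> derivable g s 1 ->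
  derivable f s 1.
Proof.
move=> oI Is fg /derivableP dg.
have gf : \near s, g s = f s.
  by have := open_nbhs_nbhs (conj oI Is); apply: filterS => t It; rewrite fg.
by have [] := near_eq_is_derive gf dg.
Qed.

Lemma mvt_on {I} {f df : R -> R} {a b : R} : is_interval I ->
  (forall s, I s -> is_derive s 1 f (df s)) -> I a -> I b -> a < b ->
  exists2 c, I c & f b - f a = df c * (b - a).
Proof.
move=> iI f' Ia Ib ab.
have sub c : c \in `[a, b] -> I c.
  by rewrite in_itv /= => /andP[ac cb]; apply: (iI a b) => //; rewrite ac.
have [||c cab ->] := MVT_segment (ltW ab) (df := df) (f := f).
- by move=> c cab; apply/f'/sub; exact: subset_itv_oo_cc.
- apply: continuous_in_subspaceT => c; rewrite inE => /sub Ic.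
  exact: is_derive_continuous (f' c Ic).
by exists c => //; exact: sub.
Qed.

Lemma derive0_const_on {I} {f : R -> R} {a b : R} : is_interval I ->
  (forall s, I s -> is_derive s 1 f 0) -> I a -> I b -> f a = f b.
Proof.
move=> iI f' Ia Ib.
have lt_eq c d : I c -> I d -> c < d -> f c = f d.
  move=> Ic Id cd; have [e _] := mvt_on iI f' Ic Id cd.
  by rewrite mul0r => /eqP; rewrite subr_eq0 => /eqP ->.
by have [/lt_eq->|/lt_eq->|->] := ltgtP a b.
Qed.

Lemma inj_of_derive_neq0 {I} {f df : R -> R} {a b : R} : is_interval I ->
  (forall s, I s -> is_derive s 1 f (df s)) -> (forall s, I s -> df s != 0) ->
  I a -> I b -> f a = f b -> a = b.
Proof.
move=> iI f' df0 Ia Ib fab.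
have lt_F c d : I c -> I d -> f c = f d -> ~ c < d.
  move=> Ic Id cd_eq cd; have [e Ie] := mvt_on iI f' Ic Id cd.
  rewrite cd_eq subrr => /esym/eqP; rewrite mulf_eq0 (negbTE (df0 e Ie)) /=.
  by rewrite subr_eq0 gt_eqF.
have [/(lt_F _ _ Ia Ib fab)//|/(lt_F _ _ Ib Ia (esym fab))//|//] := ltgtP a b.
Qed.

(** Openness comes from strict monotonicity on a small segment around the
    point, together with the intermediate value theorem. *)
Lemma image_open_interval {I} {f df : R -> R} : open_interval I ->
  (forall s, I s -> is_derive s 1 f (df s)) -> (forall s, I s -> df s != 0) ->
  open_interval (f @` I).
Proof.
move=> [oI iI [s0 Is0]] f' df0.
have fc s : I s -> {for s, continuous f}.
  by move=> /f'; exact: is_derive_continuous.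
split; last by exists (f s0); exists s0.
- rewrite openE => _ [s Is <-].
  have [e /= e0 eI] := (nbhs_ballP _ _).1 (open_nbhs_nbhs (conj oI Is)).
  pose a := s - e / 2; pose b := s + e / 2.
  have sub c : c \in `[a, b] -> I c.
    rewrite in_itv /= => /andP[ac cb]; apply: eI; rewrite /ball /= ltr_distlC.
    by apply/andP; split; move: ac cb; rewrite /a /b; lra.
  have [aab bab sab] : [/\ a \in `[a, b], b \in `[a, b] & s \in `[a, b]].
    by rewrite !in_itv /= /a /b; split; apply/andP; split; lra.
  have abc : {within `[a, b], continuous f}.
    by apply: continuous_in_subspaceT => c; rewrite inE => /sub /fc.
  have hit v : Num.min (f a) (f b) <= v <= Num.max (f a) (f b) -> (f @` I) v.
    move=> /(IVT _ abc)[|c cab <-]; first by rewrite /a /b; lra.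
    by exists c => //; exact: sub.
  have finj : {in `[a, b] &, injective f}.
    move=> c d /sub Ic /sub Id.
    exact: (inj_of_derive_neq0 iI f' df0 Ic Id).
  have near_in (v w : R) : v < f s -> f s < w ->
      (forall z, v < z -> z < w -> (f @` I) z) -> (f @` I)^° (f s).
    move=> vs sw vw.
    have : nbhs (f s) [set` `]v, w[].
      apply: open_nbhs_nbhs; split; first exact: itv_open.
      by rewrite /= in_itv /= vs sw.
    apply: filterS => z; rewrite /= in_itv /= => /andP[vz zw]; exact: vw.
  have [as_ sb] : a < s /\ s < b by rewrite /a /b; split; lra.
  have [mono|mono] := itv_continuous_inj_mono abc finj.
  + have fas : f a < f s by exact: mono.
    have fsb : f s < f b by exact: mono.
    apply: (near_in _ _ fas fsb) => z z1 z2; apply: hit.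
    by rewrite ge_min le_max (ltW z1) (ltW z2) orbT.
  + have fas : f s < f a by exact: mono.
    have fsb : f b < f s by exact: mono.
    apply: (near_in _ _ fsb fas) => z z1 z2; apply: hit.
    by rewrite ge_min le_max (ltW z1) (ltW z2) orbT.
- apply/connected_intervalP; apply: connected_continuous_connected.
    exact/connected_intervalP.
  by apply: continuous_in_subspaceT => c; rewrite inE => /fc.
Qed.

(** If [g' = p(g)], then every derivative of a polynomial in [g] is again a
    polynomial in [g], hence derivable. *)
Lemma smooth_on_horner I (g f : R -> R) (p q : {poly R}) : open I ->
  (forall s, I s -> is_derive s 1 g p.[g s]) ->
  (forall s, I s -> is_derive s 1 f q.[g s]) -> smooth_on I f.
Proof.
move=> oI g' f'.
have dn n : exists r : {poly R}, forall s, I s -> derive1n n.+1 f s = r.[g s].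
  elim: n => [|n [r rE]].
    by exists q => s Is; rewrite derive1n1 derive1E; have [_] := f' s Is.
  exists (r^`() * p) => s Is; rewrite derive1nS.
  rewrite (derive1_eq_on oI Is rE) derive1E hornerM.
  have g's := g' s Is.
  by have [_ <-] := is_derive1_comp (is_derive_poly r (g s)) g's.
case=> [|n] s Is; first by have [] := f' s Is.
have [r rE] := dn n; apply: (derivable_eq_on oI Is rE).
have g's := g' s Is.
by have [] := is_derive1_comp (is_derive_poly r (g s)) g's.
Qed.

Lemma linear_ode_exp J (k : R) (psi : R -> R) : open_interval J ->
  (forall t, J t -> is_derive t 1 psi (k * psi t)) ->
  exists c, forall t, J t -> psi t = c * expR (k * t).
Proof.
move=> [_ iJ [t0 Jt0]] psi'.
exists (psi t0 / expR (k * t0)) => t Jt.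
suff e : psi t / expR (k * t) = psi t0 / expR (k * t0).
  by rewrite -e divfK// gt_eqF// expR_gt0.
apply: (derive0_const_on iJ (f := fun t => psi t / expR (k * t))) => // s Js.
have kt : is_derive s 1 (fun t : R => k * t) k.
  by have := is_deriveZ k (is_derive_id s 1); move/is_derive_eq; apply; exact: mulr1.
have ekt := is_derive1_comp (is_derive_expR (k * s)) kt.
have E0 : expR (k * s) != 0 by rewrite gt_eqF// expR_gt0.
have := is_derive_div (psi' s Js) ekt E0.
by move/is_derive_eq; apply; rewrite /=; field.
Qed.

End Calculus.

Section Curves.
Context {R : realType}.
Implicit Types (I : set R) (c d : R -> 'rV[R]_3) (e : 'rV[R]_3) (s : R).

Lemma is_derive_coord {c s e} i :
  is_derive s 1 c e -> is_derive s 1 (fun t => c t 0 i) (e 0 i).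
Proof.
move=> [dc De]; apply: DeriveDef; first exact: (derivable_mxP _ _ _).1.
by rewrite -De derive_mx// mxE.
Qed.

Lemma is_derive_row c s e :
  (forall i, is_derive s 1 (fun t => c t 0 i) (e 0 i)) -> is_derive s 1 c e.
Proof.
move=> c'; have dc : derivable c s 1.
  by apply/derivable_mxP => i j; rewrite ord1; have [] := c' j.
by apply: DeriveDef => //; rewrite derive_mx//; apply/rowP => i; rewrite mxE;
  have [_] := c' i.
Qed.

Lemma is_derive_lorentz2 {c d s} {c' d' : 'rV[R]_3} :
  is_derive s 1 c c' -> is_derive s 1 d d' ->
  is_derive s 1 (fun t => lorentz (c t) (d t))
    (lorentz c' (d s) + lorentz (c s) d').
Proof.
move=> hc hd.
have cd i := is_deriveM (is_derive_coord i hc) (is_derive_coord i hd).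
have := is_deriveB (is_deriveD (cd 0) (cd 1)) (cd 2).
by move/is_derive_eq; apply; rewrite /lorentz /GRing.scale /=; ring.
Qed.

Lemma is_derive_lorentz {c s} {c' : 'rV[R]_3} e :
  is_derive s 1 c c' ->
  is_derive s 1 (fun t => lorentz (c t) e) (lorentz c' e).
Proof.
move=> hc; have := is_derive_lorentz2 hc (is_derive_cst e s 1).
by move/is_derive_eq; apply; rewrite /lorentz !mxE; ring.
Qed.

Lemma is_derive_scaler {r : R -> R} {s} {r' : R} e :
  is_derive s 1 r r' -> is_derive s 1 (fun t => r t *: e) (r' *: e).
Proof.
move=> hr; apply: is_derive_row => i.
have := is_deriveZ (e 0 i) hr.
rewrite (_ : e 0 i \*: r = fun t => (r t *: e) 0 i).
  by move/is_derive_eq; apply; rewrite mxE mulrC.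
by apply/funext => t; rewrite mxE mulrC.
Qed.

Lemma smooth_is_derive {I} {V : normedModType R} {c : R -> V} n {s} :
  smooth_on I c -> I s ->
  is_derive s 1 (derive1n n c) (derive1n n.+1 c s).
Proof.
by move=> sc Is; apply: DeriveDef; [exact: sc|rewrite derive1nS derive1E].
Qed.

Lemma smooth_on_lorentz I c e : open I ->
  smooth_on I c -> smooth_on I (fun s => lorentz (c s) e).
Proof.
move=> oI sc.
have dn n s : I s -> derive1n n (fun s => lorentz (c s) e) s =
    lorentz (derive1n n c s) e.
  elim: n s => [//|n IHn] s Is.
  rewrite derive1nS (derive1_eq_on oI Is IHn) derive1E.
  by have [_] := is_derive_lorentz e (smooth_is_derive n sc Is).
move=> n s Is; apply: (derivable_eq_on oI Is (dn n)).
by have [] := is_derive_lorentz e (smooth_is_derive n sc Is).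
Qed.

Lemma derive0_curve_const {I c s t} : is_interval I ->
  (forall u, I u -> is_derive u 1 c 0) -> I s -> I t -> c s = c t.
Proof.
move=> iI c' Is It; apply/rowP => i.
apply: (derive0_const_on iI (f := fun u => c u 0 i)) => // u Iu.
by have := is_derive_coord i (c' u Iu); rewrite mxE.
Qed.

(** The derivative of [c / r] is zero by the quotient rule. *)
Lemma proportional_curve {I c c'} {r r' : R -> R} : open_interval I ->
  (forall s, I s -> is_derive s 1 c (c' s)) ->
  (forall s, I s -> is_derive s 1 r (r' s)) ->
  (forall s, I s -> r s != 0) ->
  (forall s, I s -> r s *: c' s = r' s *: c s) ->
  exists e, forall s, I s -> c s = r s *: e.
Proof.
move=> [_ iI [s0 Is0]] hc hr r0 prop.
exists ((r s0)^-1 *: c s0) => s Is; apply/rowP => i; rewrite !mxE.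
suff e : c s 0 i / r s = c s0 0 i / r s0.
  by rewrite [X in _ * X]mulrC -e mulrC divfK// r0.
apply: (derive0_const_on iI (f := fun t => c t 0 i / r t)) => // t It.
have := is_derive_div (is_derive_coord i (hc t It)) (hr t It) (r0 t It).
move/is_derive_eq; apply; have := congr1 (fun v : 'rV[R]_3 => v 0 i) (prop t It).
by rewrite !mxE mulrC => ->; rewrite [r' t * _]mulrC subrr mul0r.
Qed.

End Curves.

(** * Pseudo-null curves and maximal translation surfaces *)

Section Geometry.
Context {R : realType}.
Implicit Types (I J : set R) (c alpha beta : R -> 'rV[R]_3).

Lemma derive_const_on {I} {f : R -> R} {k s df : R} : open I ->
  (forall t, I t -> f t = k) -> I s -> is_derive s 1 f df -> df = 0.
Proof.
move=> oI fk Is [_ <-].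
have e : derive1 f s = derive1 (cst k) s by exact: derive1_eq_on oI Is fk.
by rewrite -derive1E e derive1_cst.
Qed.

(** The difference quotients of both sides are the same function; thus the
    partial derivatives of a translation surface are those of its generating
    curves. *)
Lemma derive1_addr (V : normedModType R) (f : R -> V) (v : V) :
  derive1 (fun s => f s + v) = derive1 f.
Proof.
apply/funext => s; rewrite /derive1.
set d := (fun _ : R => _); set d' := (fun _ : R => _).
suff -> : d = d' by [].
by apply/funext => h; rewrite /d /d' /= opprD addrACA subrr addr0.
Qed.

Lemma derive1_addl (V : normedModType R) (f : R -> V) (v : V) :
  derive1 (fun s => v + f s) = derive1 f.
Proof.
by rewrite -(derive1_addr _ f v); congr derive1; apply/funext => s; rewrite addrC.
Qed.

Lemma unit_speed {I c s} : spacelike_curve I c -> arc_length I c -> I s ->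
  lorentz (derive1 c s) (derive1 c s) = 1.
Proof.
move=> sp al Is; have := al s Is; case: (sp s Is) => [/gtr0_norm -> //|->].
rewrite /lorentz !mxE !mulr0 addr0 subrr normr0 => /esym/eqP.
by rewrite oner_eq0.
Qed.

Lemma lorentz_const_derive {I c d s k} {c' d' : 'rV[R]_3} : open I ->
  (forall t, I t -> lorentz (c t) (d t) = k) -> I s ->
  is_derive s 1 c c' -> is_derive s 1 d d' ->
  lorentz c' (d s) + lorentz (c s) d' = 0.
Proof.
move=> oI cdk Is hc hd.
exact: derive_const_on oI cdk Is (is_derive_lorentz2 hc hd).
Qed.

Lemma lorentz_const_derive1 {I c s k} {c' : 'rV[R]_3} : open I ->
  (forall t, I t -> lorentz (c t) (c t) = k) -> I s ->
  is_derive s 1 c c' -> lorentz c' (c s) = 0.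
Proof.
move=> oI cck Is hc; have := lorentz_const_derive oI cck Is hc hc.
by rewrite (lorentzC (c s)); lra.
Qed.

(** Here [c1], [c2], [c3] stand for the first three derivatives of a
    pseudo-null curve.  Differentiating [<c2, c2> = 0] and [<c1, c2> = 0]
    shows that [c3] is orthogonal to [c2] and [c1], hence a multiple of [c2]:
    the direction of [c2] is constant. *)
Lemma lightlike_acceleration {J} {c1 c2 c3 : R -> 'rV[R]_3} :
  open_interval J ->
  (forall t, J t -> is_derive t 1 c1 (c2 t)) ->
  (forall t, J t -> is_derive t 1 c2 (c3 t)) ->
  (forall t, J t -> lorentz (c1 t) (c1 t) = 1) ->
  (forall t, J t -> lightlike (c2 t)) ->
  exists b n : 'rV[R]_3,
    [/\ lorentz b b = 1, lorentz b n = 0, lorentz n n = 0 & n 0 2 = 1] /\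
    forall t, J t ->
      [/\ c1 t = b + c1 t 0 2 *: n, c2 t = c2 t 0 2 *: n & c2 t 0 2 != 0].
Proof.
move=> oiJ d1 d2 b11 ll; have [oJ iJ [t0 Jt0]] := oiJ.
have b21 t : J t -> lorentz (c2 t) (c1 t) = 0.
  by move=> Jt; exact: (lorentz_const_derive1 oJ b11 Jt (d1 t Jt)).
have b22 t : J t -> lorentz (c2 t) (c2 t) = 0 by move=> /ll[].
have b2z t : J t -> c2 t 0 2 != 0 by move=> /ll; exact: lightlike_third.
have [n nE] : exists n, forall t, J t -> c2 t = c2 t 0 2 *: n.
  apply: (proportional_curve oiJ d2 (r := fun t => c2 t 0 2)
    (r' := fun t => c3 t 0 2) _ b2z).
    by move=> t Jt; exact: is_derive_coord (d2 t Jt).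
  move=> t Jt.
  have b32 : lorentz (c3 t) (c2 t) = 0.
    exact: (lorentz_const_derive1 oJ b22 Jt (d2 t Jt)).
  have b31 : lorentz (c3 t) (c1 t) = 0.
    have := lorentz_const_derive oJ b21 Jt (d2 t Jt) (d1 t Jt).
    by rewrite (b22 t Jt) addr0.
  have b12 : lorentz (c1 t) (c2 t) = 0 by rewrite lorentzC b21.
  rewrite {1}(orth_lightlike_collinear _ _ _ (b11 t Jt) (b22 t Jt) b12
    (b2z t Jt) b31 b32).
  by rewrite scalerA mulrC (divfK (b2z t Jt)).
have b1n t : J t -> lorentz (c1 t) n = 0.
  move=> Jt; apply: (mulfI (b2z t Jt)).
  by rewrite mulr0 -lorentzZr -nE// lorentzC b21.
have n2 : n 0 2 = 1.
  have := congr1 (fun v : 'rV[R]_3 => v 0 2) (nE t0 Jt0).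
  rewrite mxE -[LHS]mulr1 => e.
  by rewrite (mulfI (b2z t0 Jt0) e).
have nn : lorentz n n = 0.
  apply: (mulfI (b2z t0 Jt0)); apply: (mulfI (b2z t0 Jt0)).
  by rewrite -lorentzZr -lorentzZl -nE// b22// !mulr0.
pose b := c1 t0 - c1 t0 0 2 *: n.
exists b, n; split.
  have n1 : lorentz n (c1 t0) = 0 by rewrite lorentzC b1n.
  by split=> //; rewrite /b !lorentzE ?n1 ?b11 ?b1n ?nn //; ring.
move=> t Jt; split; [|exact: nE|exact: b2z].
have e : c1 t - c1 t 0 2 *: n = b.
  apply: (derive0_curve_const (c := fun t => c1 t - c1 t 0 2 *: n) iJ _ Jt Jt0).
  move=> u Ju.
  have := is_deriveB (d1 u Ju)
    (is_derive_scaler n (is_derive_coord 2 (d1 u Ju))).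
  by move/is_derive_eq; apply; rewrite -nE// subrr.
by rewrite -e subrK.
Qed.

Section MaximalSurface.
Variables (I J : set R) (alpha beta : R -> 'rV[R]_3).
Local Notation X := (translation_map alpha beta).

Lemma translation_X_s s t : X_s X s t = derive1 alpha s.
Proof. by rewrite /X_s derive1_addr. Qed.

Lemma translation_X_t s t : X_t X s t = derive1 beta t.
Proof. by rewrite /X_t derive1_addl. Qed.

Lemma translation_X_ss s t : X_ss X s t = derive1n 2 alpha s.
Proof.
have e : X_s X ^~ t = derive1 alpha.
  by apply/funext => u; exact: translation_X_s.
by rewrite /X_ss e.
Qed.

Lemma translation_X_st s t : X_st X s t = 0.
Proof.
rewrite /X_st (_ : X_s X s = cst (derive1 alpha s)) ?derive1_cst//.
by apply/funext => u; exact: translation_X_s.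
Qed.

Lemma translation_X_tt s t : X_tt X s t = derive1n 2 beta t.
Proof.
have e : X_t X s = derive1 beta.
  by apply/funext => u; exact: translation_X_t.
by rewrite /X_tt e.
Qed.

Hypothesis alpha_unit :
  forall s, I s -> lorentz (derive1 alpha s) (derive1 alpha s) = 1.
Hypothesis beta_unit :
  forall t, J t -> lorentz (derive1 beta t) (derive1 beta t) = 1.

(** This is the discriminant of the first fundamental form; the vector
    [- F X_s + X_t] exhibits it. *)
Lemma spacelike_angle s t : spacelike_surface X I J -> I s -> J t ->
  lorentz (derive1 alpha s) (derive1 beta t) ^+ 2 < 1.
Proof.
move=> sp Is Jt.
have := sp s t Is Jt (- lorentz (derive1 alpha s) (derive1 beta t)) 1.
rewrite /Defs.coefE /coefF /coefG translation_X_s translation_X_t.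
move: (derive1 alpha s) (derive1 beta t) (alpha_unit s Is) (beta_unit t Jt).
move=> a1 b1 aa bb; rewrite aa bb => pos.
have : 0 < 1 - lorentz a1 b1 ^+ 2.
  have -> : forall x : R, 1 - x ^+ 2 =
    (- x) ^+ 2 * 1 + 2 * - x * 1 * x + 1 ^+ 2 * 1 by move=> x; ring.
  by apply: pos => -[_ /eqP]; rewrite oner_eq0.
by rewrite subr_gt0.
Qed.

Lemma maximal_det s t : maximal_surface X I J -> I s -> J t ->
  lorentz (lcross (derive1 alpha s) (derive1 beta t))
    (derive1n 2 alpha s + derive1n 2 beta t) = 0.
Proof.
move=> [sp H] Is Jt; have F1 := spacelike_angle s t sp Is Jt.
move: (H s t Is Jt).
rewrite /mean_curvature /unit_normal /Defs.coefE /coefF /coefG.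
rewrite translation_X_s translation_X_t translation_X_ss translation_X_st.
rewrite translation_X_tt.
move: (derive1 alpha s) (derive1 beta t) (alpha_unit s Is) (beta_unit t Jt) F1.
move: (derive1n 2 alpha s) (derive1n 2 beta t) => a2 b2 a1 b1 aa bb F1.
rewrite lcross_gram aa bb !mulr1.
set w := lcross _ _; set F := lorentz a1 _ in F1 *.
rewrite (_ : lorentz _ (0 : 'rV[R]_3) = 0); last by rewrite /lorentz !mxE; ring.
rewrite mulr0 mul0r subr0 !lorentzE -mulrDr.
have F0 : 0 < 1 - F ^+ 2 by rewrite subr_gt0.
move=> /eqP; rewrite oppr_eq0 !mulf_eq0 invr_eq0 invr_eq0 sqrtr_eq0.
rewrite leNgt F0 /= mulf_eq0 (gt_eqF F0) pnatr_eq0 !orbF => /eqP.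
exact.
Qed.

End MaximalSurface.

(** If [a] were orthogonal to [n], the component of [a] orthogonal to [b] would
    be a multiple of [n], hence of zero norm, whereas its norm is
    [1 - <a, b>^2]. *)
Lemma spacelike_transversal (a b n : 'rV[R]_3) :
  lorentz a a = 1 -> lorentz b b = 1 -> lorentz b n = 0 -> lorentz n n = 0 ->
  n 0 2 != 0 -> lorentz a b ^+ 2 < 1 -> lorentz a n != 0.
Proof.
move=> aa bb bn nn n2 ab1; apply/eqP => an.
pose y := a - lorentz a b *: b.
have yE : y = (y 0 2 / n 0 2) *: n.
  apply: (orth_lightlike_collinear b) => //; rewrite /y !lorentzE.
  - by rewrite bb; ring.
  - by rewrite an bn; ring.
have yy0 : lorentz y y = 0 by rewrite yE !lorentzE nn !mulr0.
have : lorentz y y = 1 - lorentz a b ^+ 2.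
  by rewrite /y !lorentzE aa bb (lorentzC b a); ring.
by rewrite yy0 => /esym; move: ab1; lra.
Qed.

End Geometry.

(** * The maximality equation along the generating curves *)

Section Classification.
Context {R : realType}.
Implicit Types (I J : set R).

Lemma open_interval_two_points {J} : open_interval J ->
  exists t0 t1 : R, [/\ J t0, J t1 & t0 < t1].
Proof.
move=> [oJ _ [t0 Jt0]].
have [e /= e0 eJ] := (nbhs_ballP _ _).1 (open_nbhs_nbhs (conj oJ Jt0)).
exists t0, (t0 + e / 2); split=> //; last by lra.
by apply: eJ; rewrite /ball /= opprD addrA subrr sub0r normrN gtr0_norm; lra.
Qed.

(** The maximality equation at one fixed [s] determines [beta'], by a linear
    differential equation; at all [s], with this [beta'], it splits into the
    constant and the exponential part. *)
Lemma exponential_form {I J} {a1 a2 b1 b2 b3 : R -> 'rV[R]_3} :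
  I !=set0 -> open_interval J ->
  (forall s, I s -> lorentz (a1 s) (a1 s) = 1) ->
  (forall s, I s -> lorentz (a2 s) (a1 s) = 0) ->
  (forall s, I s -> 0 < lorentz (a2 s) (a2 s)) ->
  (forall t, J t -> is_derive t 1 b1 (b2 t)) ->
  (forall t, J t -> is_derive t 1 b2 (b3 t)) ->
  (forall t, J t -> lorentz (b1 t) (b1 t) = 1) ->
  (forall t, J t -> lightlike (b2 t)) ->
  (forall s t, I s -> J t -> lorentz (a1 s) (b1 t) ^+ 2 < 1) ->
  (forall s t, I s -> J t ->
     lorentz (lcross (a1 s) (b1 t)) (a2 s + b2 t) = 0) ->
  exists (b n : 'rV[R]_3) (k c : R),
    [/\ [/\ lorentz b b = 1, lorentz b n = 0 & lorentz n n = 0],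
        k != 0 /\ c != 0,
        forall t, J t -> b1 t = b + (c * expR (k * t)) *: n &
        forall s, I s ->
          [/\ lorentz (a1 s) n != 0,
              lorentz (a2 s) n * (1 - lorentz (a1 s) b ^+ 2)
              + lorentz (a1 s) n * lorentz (a1 s) b * lorentz (a2 s) b = 0 &
              lorentz (a1 s) n * lorentz (a2 s) b
              - lorentz (a1 s) b * lorentz (a2 s) n = k * lorentz (a1 s) n]].
Proof.
move=> [s0 Is0] oiJ aa a21 a22 db1 db2 bb1 ll ab H.
have [b0 [n [[bb0 bn0 nn n2] bE]]] := lightlike_acceleration oiJ db1 db2 bb1 ll.
have [t0 [t1 [Jt0 Jt1 t01]]] := open_interval_two_points oiJ.
have C0 s : I s -> lorentz (a1 s) n != 0.
  move=> Is; have [bE1 _ _] := bE t0 Jt0.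
  apply: (spacelike_transversal _ (b1 t0)) => //; rewrite ?aa ?bb1 ?ab//.
    by rewrite bE1 lorentzE bn0 lorentzE nn mulr0 addr0.
  by rewrite n2 oner_eq0.
set C := lorentz (a1 s0) n; set h := lorentz (a1 s0) b0.
set j := lorentz (a2 s0) b0; set D := lorentz (a2 s0) n.
have Cs0 : C != 0 by exact: C0.
pose k := (C * j - h * D) / C.
pose p := (D * (1 - h ^+ 2) + C * h * j) / C ^+ 2.
have phiE t : J t -> b2 t 0 2 = p + k * b1 t 0 2.
  move=> Jt; have [bE1 bE2 _] := bE t Jt.
  have e : lorentz (lcross (a1 s0) (b0 + b1 t 0 2 *: n))
      (a2 s0 + b2 t 0 2 *: n) = 0 by rewrite -bE1 -bE2 H.
  have := maximal_identity _ _ _ _ (aa s0 Is0) (a21 s0 Is0) bb0 bn0 nn _ _ e.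
  rewrite -/C -/h -/j -/D => {}e.
  apply: (mulIf (expf_neq0 2 Cs0)); rewrite -e /p /k; field.
  exact: Cs0.
have k0 : k != 0.
  have := sqr_slope _ _ _ _ (aa s0 Is0) (a21 s0 Is0) bb0 bn0 nn Cs0.
  rewrite -/C -/h -/j -/D => e.
  rewrite mulf_neq0 ?invr_neq0//.
  have Cg : C ^+ 2 * lorentz (a2 s0) (a2 s0) != 0.
    by rewrite mulf_neq0 ?expf_neq0// gt_eqF// a22.
  rewrite -sqrf_eq0 e paddr_eq0 ?sqr_ge0//; last first.
    by rewrite mulr_ge0 ?sqr_ge0// ltW// a22.
  by rewrite negb_and Cg orbT.
(* The shift by [p / k] turns [phi = p + k Phi] into [psi' = k psi]. *)
pose psi t := b1 t 0 2 + p / k.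
have [c cE] : exists c, forall t, J t -> psi t = c * expR (k * t).
  apply: (linear_ode_exp _ _ _ oiJ) => t Jt.
  have := is_deriveD (is_derive_coord 2 (db1 t Jt)) (is_derive_cst (p / k) t 1).
  move/is_derive_eq; apply; rewrite addr0 phiE// /psi; field.
  exact: k0.
have phi_psi t : J t -> b2 t 0 2 = k * psi t.
  by move=> Jt; rewrite phiE// /psi; field; exact: k0.
have c0 : c != 0.
  have [_ _ ] := bE t0 Jt0; rewrite phi_psi// cE//.
  by apply: contra_neq => ->; rewrite mul0r mulr0.
pose b := b0 - (p / k) *: n.
have bb : lorentz b b = 1.
  by rewrite /b !lorentzE (lorentzC n b0) bb0 bn0 nn; ring.
have bn : lorentz b n = 0 by rewrite /b !lorentzE bn0 nn; ring.
have b1E t : J t -> b1 t = b + psi t *: n.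
  move=> Jt; have [-> _ _] := bE t Jt.
  by rewrite /b /psi scalerDl [_ *: n + _]addrC addrA subrK.
exists b, n, k, c; split=> //.
  by move=> t Jt; rewrite -cE// b1E.
move=> s Is; have Cs := C0 s Is.
have eq_t t : J t ->
    lorentz (a2 s) n * (1 - lorentz (a1 s) b ^+ 2)
    + lorentz (a1 s) n * lorentz (a1 s) b * lorentz (a2 s) b
    + psi t * (lorentz (a1 s) n * (lorentz (a1 s) n * lorentz (a2 s) b
        - lorentz (a1 s) b * lorentz (a2 s) n))
    = k * psi t * lorentz (a1 s) n ^+ 2.
  move=> Jt; apply: maximal_identity => //; rewrite ?aa ?a21//.
  by rewrite -b1E// -phi_psi//; have [_ <- _] := bE t Jt; exact: H.
have := eq_t t0 Jt0; have := eq_t t1 Jt1.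
set P := _ + _ * lorentz (a2 s) b; set Q := _ - _ * lorentz (a2 s) n.
move: Cs; move: (lorentz (a1 s) n) => Cs Cs0' e1 e0.
(* The equation is affine in [psi t]; two distinct values separate its parts. *)
have psi01 : psi t0 - psi t1 != 0.
  rewrite !cE// -mulrBr mulf_neq0// subr_eq0 (inj_eq (@expR_inj R)).
  by rewrite (inj_eq (mulfI k0)) lt_eqF.
have Q0 : Q = k * Cs.
  apply: (mulfI Cs0'); apply: (mulfI psi01).
  by move: e0 e1; nra.
split=> //; move: e0; rewrite Q0; lra.
Qed.
End Classification.

(** * The adapted frame and the profile function *)

Section AdaptedFrame.
Context {R : realType}.
Implicit Types (I J K : set R).

Definition orthonormal_frame (e1 e2 e3 : 'rV[R]_3) : Prop :=
  [/\ lorentz e1 e1 = 1, lorentz e2 e2 = 1 & lorentz e3 e3 = -1] /\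
  [/\ lorentz e1 e2 = 0, lorentz e1 e3 = 0 & lorentz e2 e3 = 0].

Lemma orthonormal_decomposition {e1 e2 e3 : 'rV[R]_3} w :
  orthonormal_frame e1 e2 e3 ->
  w = lorentz w e1 *: e1 + lorentz w e2 *: e2 - lorentz w e3 *: e3.
Proof.
move=> [[e11 e22 e33] [e12 e13 e23]]; apply/eqP; rewrite -subr_eq0; apply/eqP.
apply: (lorentz_basis_eq0 e1 e2 e3).
- have := det_mul_gram e1 e2 e3 e1 e2 e3.
  rewrite (lorentzC e2 e1) (lorentzC e3 e1) (lorentzC e3 e2) e11 e22 e33 e12 e13 e23.
  by move=> e; apply/eqP => d0; move: e; rewrite d0; lra.
- by rewrite !lorentzE (lorentzC e2 e1) (lorentzC e3 e1) e11 e12 e13; ring.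
- by rewrite !lorentzE (lorentzC e3 e2) e22 e12 e23; ring.
- by rewrite !lorentzE e33 e13 e23; ring.
Qed.

(** The coordinate along [e3] is [- lorentz p e3] because [e3] is timelike. *)
Definition frame_coords (e1 e2 e3 p : 'rV[R]_3) : 'rV[R]_3 :=
  vec3 (lorentz p e1) (lorentz p e2) (- lorentz p e3).

(** Coordinates in an orthonormal frame preserve the metric, by expanding one of
    the two vectors in that frame. *)
Lemma frame_coords_rigid {e1 e2 e3 : 'rV[R]_3} q :
  orthonormal_frame e1 e2 e3 ->
  rigid_motion (fun p => frame_coords e1 e2 e3 p + q).
Proof.
move=> fr.
exists (\matrix_(i < 3) frame_coords e1 e2 e3 (delta_mx 0 i)), q.
have mulE p : p *m (\matrix_(i < 3) frame_coords e1 e2 e3 (delta_mx 0 i)) =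
    frame_coords e1 e2 e3 p.
  have sum3 (F : 'I_3 -> R) : \sum_(i < 3) F i = F 0 + F 1 + F 2.
    rewrite !big_ord_recl big_ord0 addr0 addrA.
    by congr (_ + F _ + F _); exact/val_inj.
  apply: rowP3; rewrite mxE sum3 !mxE /frame_coords /lorentz ?vec3E !mxE /=;
    ring.
split=> [v w|p]; last by rewrite mulE.
rewrite !mulE [in RHS](orthonormal_decomposition w fr) !lorentzE.
by rewrite {1}/lorentz /frame_coords !vec3E; ring.
Qed.

(** The constant vector [M = (a1 - <a1, b> b) / <a1, n>] satisfies
    [<M, b> = 0], [<M, n> = 1] and [<M, M> > 0].  Normalizing it to
    [e1 = nu M] gives [<n, e1> = nu], and [e3 = n / nu - e1] is then forced by
    [n = nu (e1 + e3)]; it is a timelike unit vector since [n] is lightlike. *)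
Lemma adapted_frame {I} {a1 a2 : R -> 'rV[R]_3} {b n : 'rV[R]_3} {k : R} :
  open_interval I ->
  (forall s, I s -> is_derive s 1 a1 (a2 s)) ->
  (forall s, I s -> lorentz (a1 s) (a1 s) = 1) ->
  (forall s, I s -> lorentz (a2 s) (a1 s) = 0) ->
  (forall s, I s -> 0 < lorentz (a2 s) (a2 s)) ->
  lorentz b b = 1 -> lorentz b n = 0 -> lorentz n n = 0 ->
  (forall s, I s ->
    [/\ lorentz (a1 s) n != 0,
        lorentz (a2 s) n * (1 - lorentz (a1 s) b ^+ 2)
        + lorentz (a1 s) n * lorentz (a1 s) b * lorentz (a2 s) b = 0 &
        lorentz (a1 s) n * lorentz (a2 s) b
        - lorentz (a1 s) b * lorentz (a2 s) n = k * lorentz (a1 s) n]) ->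
  exists (e1 e3 : 'rV[R]_3) (nu : R),
    [/\ orthonormal_frame e1 (- b) e3, nu != 0, n = nu *: (e1 + e3) &
      forall s, I s ->
        [/\ a1 s = lorentz (a1 s) e1 *: e1 + lorentz (a1 s) (- b) *: - b,
            lorentz (a1 s) e1 != 0 &
            lorentz (a1 s) e1 * lorentz (a2 s) (- b)
            - lorentz (a1 s) (- b) * lorentz (a2 s) e1
              = - k * lorentz (a1 s) e1]].
Proof.
move=> oiI da aa a21 a22 bb bn nn eqs.
have [M ME] : exists M, forall s, I s ->
    a1 s - lorentz (a1 s) b *: b = lorentz (a1 s) n *: M.
  apply: (proportional_curve oiI
    (c' := fun s => a2 s - lorentz (a2 s) b *: b)
    (r' := fun s => lorentz (a2 s) n)) => s Is.
  - have := is_deriveB (da s Is)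
      (is_derive_scaler b (is_derive_lorentz b (da s Is))).
    by move/is_derive_eq; apply.
  - exact: is_derive_lorentz (da s Is).
  - by have [] := eqs s Is.
  - have [C0 P0 _] := eqs s Is.
    exact: (frame_const _ _ _ _ (aa s Is) (a21 s Is)).
have [_ _ [s0 Is0]] := oiI.
have a1E s : I s -> a1 s = lorentz (a1 s) b *: b + lorentz (a1 s) n *: M.
  by move=> Is; rewrite -ME// addrC subrK.
have [C0 P0 Q0] := eqs s0 Is0.
have [_ _ g0] := solve_frame _ _ _ _ (aa s0 Is0) (a21 s0 Is0) bb bn nn _ C0 P0 Q0.
have Mb : lorentz M b = 0.
  apply: (mulfI C0); rewrite -lorentzZl -ME// !lorentzE bb; ring.
have Mn : lorentz M n = 1.
  by apply: (mulfI C0); rewrite -lorentzZl -ME// !lorentzE bn; ring.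
have MM : 0 < lorentz M M.
  have h1 : 0 < 1 - lorentz (a1 s0) b ^+ 2.
    have := a22 s0 Is0; rewrite g0 pmulr_rgt0//.
    rewrite lt_neqAle sqr_ge0 andbT eq_sym sqrf_eq0.
    apply/eqP => k0; have := a22 s0 Is0.
    by rewrite g0 k0 expr0n mul0r ltxx.
  have C2 : 0 < lorentz (a1 s0) n ^+ 2 by rewrite lt_neqAle sqr_ge0 eq_sym expf_neq0.
  rewrite -(pmulr_rgt0 _ C2); move: h1; congr (_ < _).
  rewrite [RHS](_ : _ = lorentz (lorentz (a1 s0) n *: M) (lorentz (a1 s0) n *: M));
    last by rewrite !lorentzE; ring.
  rewrite -ME// !lorentzE aa// bb.
  by rewrite (lorentzC b (a1 s0)); ring.
pose nu := (Num.sqrt (lorentz M M))^-1.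
have nu0 : nu != 0 by rewrite invr_neq0// gt_eqF// sqrtr_gt0.
have nuM : nu ^+ 2 * lorentz M M = 1.
  by rewrite /nu exprVn sqr_sqrtr ?ltW// mulVf// gt_eqF.
pose e1 := nu *: M; have e1E : e1 = nu *: M by [].
have e11 : lorentz e1 e1 = 1 by rewrite /e1 !lorentzE mulrA -expr2.
have e1n : lorentz e1 n = nu by rewrite /e1 !lorentzE Mn mulr1.
have e1b : lorentz e1 b = 0 by rewrite /e1 !lorentzE Mb mulr0.
have nV : nu^-1 * nu = 1 by rewrite mulVf.
clearbody e1; pose e3 := nu^-1 *: n - e1.
exists e1, e3, nu; split=> //.
- split; split=> //.
  + by rewrite !lorentzE bb opprK.
  + by rewrite /e3 !lorentzE nn (lorentzC n e1) e1n e11 nV; ring.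
  + by rewrite lorentzNr e1b oppr0.
  + by rewrite /e3 !lorentzE e1n e11 nV subrr.
  + by rewrite /e3 !lorentzE bn (lorentzC b e1) e1b; ring.
- by rewrite /e3 addrC subrK scalerA mulfV// scale1r.
move=> s Is; have [Cs Ps Qs] := eqs s Is.
have uE v : lorentz v e1 = nu * lorentz v M by rewrite e1E lorentzZr.
have a1M : lorentz (a1 s) M = lorentz (a1 s) n * lorentz M M.
  by rewrite {1}a1E// !lorentzE (lorentzC b) Mb; ring.
have a2M : lorentz (a2 s) M = lorentz (a2 s) n * lorentz M M.
  have := frame_const _ _ _ _ (aa s Is) (a21 s Is) bb bn nn Cs Ps.
  rewrite ME// => /(congr1 (fun v => lorentz v M)).
  rewrite !lorentzE (lorentzC b) Mb mulr0 subr0 mulrCA => e.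
  exact: mulfI Cs _ _ e.
split.
- rewrite lorentzE scalerN scaleNr opprK addrC {1}a1E//; congr (_ + _).
  rewrite uE a1M e1E scalerA -[X in X *: M]mulr1 -nuM; congr (_ *: _).
  by ring.
- by rewrite uE a1M !mulf_neq0// gt_eqF.
- by rewrite !uE a1M a2M !lorentzE; move: Qs; nra.
Qed.

Lemma is_derive_affine (k a s : R) : is_derive s 1 (fun y : R => k * y + a) k.
Proof.
have := is_deriveD (is_deriveZ k (is_derive_id s 1)) (is_derive_cst a s 1).
by move/is_derive_eq; apply; rewrite addr0 /GRing.scale /= mulr1.
Qed.

Lemma is_derive_tan_affine (k a y : R) : cos (k * y + a) != 0 ->
  is_derive y 1 (fun y => tan (k * y + a)) (k * (1 + tan (k * y + a) ^+ 2)).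
Proof.
move=> c0; have t' := is_derive_tan c0.
have := @is_derive1_comp _ tan (fun y => k * y + a) y _ _ t'
  (is_derive_affine k a y).
move/is_derive_eq; apply; rewrite mulrC; congr (_ * _).
have := cos2Dsin2 (k * y + a); rewrite /tan => e.
by rewrite -[LHS]mul1r -[X in X * _ = _]e; field.
Qed.

Lemma is_derive_ln_cos (k a c y : R) : k != 0 -> 0 < cos (k * y + a) ->
  is_derive y 1 (fun y => c + k^-1 * ln (cos (k * y + a))) (- tan (k * y + a)).
Proof.
move=> k0 c0; have cos' := @is_derive1_comp _ cos (fun y => k * y + a) y _ _
  (is_derive_cos (k * y + a)) (is_derive_affine k a y).
have ln' := @is_derive1_comp _ (@ln R) (cos \o (fun y => k * y + a)) y _ _
  (is_derive1_ln c0) cos'.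
have := is_deriveD (is_derive_cst c y 1) (is_deriveZ k^-1 ln').
move/is_derive_eq; apply; rewrite add0r /GRing.scale /= /tan; field.
by rewrite gt_eqF//= k0.
Qed.

Lemma cos_atan_gt0 (x : R) : 0 < cos (atan x).
Proof. by rewrite cos_atan invr_gt0 sqrtr_gt0 ltr_wpDr// sqr_ge0. Qed.

Lemma smooth_on_log_cosine K (f : R -> R) (k a : R) : open K ->
  (forall y, K y -> cos (k * y + a) != 0) ->
  (forall y, K y -> is_derive y 1 f (- tan (k * y + a))) -> smooth_on K f.
Proof.
move=> oK c0 f'.
apply: (smooth_on_horner K (fun y => tan (k * y + a)) f
  (k%:P * (1 + 'X ^+ 2)) (- 'X) oK) => y Ky.
- have := is_derive_tan_affine _ _ _ (c0 y Ky).
  by move/is_derive_eq; apply; rewrite !hornerE.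
- by have := f' y Ky; move/is_derive_eq; apply; rewrite !hornerE.
Qed.

(** The function [atan (v / u)] has derivative
    [(u v' - v u') / (u^2 + v^2) = - k u], so [k x + atan (v / u)] is a
    constant [- a].  Taking [a] from the principal value of the arctangent
    makes [cos (k x + a)] positive, and [f] can be given in closed form by
    [f z = c + ln (cos (k z + a)) / k], without inverting [x]. *)
Lemma profile_of_angle_ode {I} {x y u v u' v' : R -> R} {k : R} :
  open_interval I -> k != 0 ->
  (forall s, I s -> is_derive s 1 x (u s)) ->
  (forall s, I s -> is_derive s 1 y (v s)) ->
  (forall s, I s -> is_derive s 1 u (u' s)) ->
  (forall s, I s -> is_derive s 1 v (v' s)) ->
  (forall s, I s -> u s != 0) ->
  (forall s, I s -> u s ^+ 2 + v s ^+ 2 = 1) ->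
  (forall s, I s -> u s * v' s - v s * u' s = - k * u s) ->
  exists (f : R -> R) (a : R),
    [/\ smooth_on (x @` I) f, forall s, I s -> y s = f (x s) &
        forall z, (x @` I) z ->
          cos (k * z + a) != 0 /\ derive1 f z = - tan (k * z + a)].
Proof.
move=> oiI k0 dx dy du dv u0 uv ode; have [oI iI [s0 Is0]] := oiI.
pose a := - atan (v s0 / u s0) - k * x s0.
have angle s : I s -> k * x s + a = - atan (v s / u s).
  move=> Is.
  suff : k * x s + atan (v s / u s) = k * x s0 + atan (v s0 / u s0).
    by rewrite /a; lra.
  apply: (derive0_const_on iI (f := fun s => k * x s + atan (v s / u s)))
    => // t It.
  have q := is_derive_div (dv t It) (du t It) (u0 t It).
  have := is_deriveD (is_deriveZ k (dx t It))
    (@is_derive1_comp _ (@atan R) (fun s => v s / u s) t _ _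
      (is_derive1_atan (v t / u t)) q).
  move/is_derive_eq; apply; rewrite /GRing.scale /=.
  have ut0 := u0 t It.
  have -> : v' t * u t - v t * u' t = - k * u t by rewrite -ode//; ring.
  have -> : 1 + (v t / u t) ^+ 2 = (u t ^+ 2)^-1.
    rewrite -[RHS]mul1r -[X in _ = X * _](uv t It); field.
    exact: ut0.
  by field.
have cos_gt0 z : (x @` I) z -> 0 < cos (k * z + a).
  by move=> [s Is <-]; rewrite angle// cosN cos_atan_gt0.
have oK : open (x @` I) by have [] := image_open_interval oiI dx u0.
pose g z := k^-1 * ln (cos (k * z + a)).
pose c := y s0 - g (x s0).
pose f z := c + g z.
have f' z : (x @` I) z -> is_derive z 1 f (- tan (k * z + a)).
  by move=> Kz; exact: is_derive_ln_cos (cos_gt0 z Kz).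
exists f, a; split.
- by apply: smooth_on_log_cosine f' => // z Kz; rewrite gt_eqF// cos_gt0.
- move=> s Is.
  suff : y s - f (x s) = y s0 - f (x s0).
    by rewrite [f (x s0)]subrK subrr => /eqP; rewrite subr_eq0 => /eqP.
  apply: (derive0_const_on iI (f := fun s => y s - f (x s))) => // t It.
  have Kxt : (x @` I) (x t) by exists t.
  have := is_deriveB (dy t It) (is_derive1_comp (f' (x t) Kxt) (dx t It)).
  move/is_derive_eq; apply.
  by rewrite angle// tanN atanK opprK divfK ?subrr// u0.
- move=> z Kz; split; first by rewrite gt_eqF// cos_gt0.
  by rewrite derive1E; have [_] := f' z Kz.
Qed.

End AdaptedFrame.

(** * Normal form of the surface *)

Section NormalForm.
Context {R : realType}.
Implicit Types (I J K : set R).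

Lemma free_orthogonal (u v : 'rV[R]_3) :
  lorentz u u != 0 -> lorentz u v = 0 -> v != 0 -> free [:: u; v].
Proof.
move=> uu uv v0; rewrite free_cons seq1_free v0 andbT span_seq1.
apply/vlineP => -[c uE]; move: uu.
by rewrite {2}uE lorentzZr uv mulr0 eqxx.
Qed.

Lemma planar_image I (c : R -> 'rV[R]_3) (p u v : 'rV[R]_3) (x y : R -> R) :
  free [:: u; v] -> (forall s, I s -> c s = p + x s *: u + y s *: v) ->
  planar (c @` I).
Proof.
move=> uv cE; exists [set q | exists a b : R, q = p + a *: u + b *: v].
split; first by exists p, u, v.
by move=> _ [s Is <-]; exists (x s), (y s); exact: cE.
Qed.

Lemma unit_neq0 (v : 'rV[R]_3) : lorentz v v = 1 -> v != 0.
Proof.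
move=> vv; apply/eqP => v0; move: vv; rewrite v0 /lorentz !mxE mul0r addr0 subrr.
by move/esym/eqP; rewrite oner_eq0.
Qed.

(** The adapted frame has [e2 = - b].  Integrating [alpha' = u e1 + v e2] and
    [beta' = b + c e^(kt) nu (e1 + e3)] gives both parametrizations, with
    [m = c nu / k]. *)
Lemma normal_form {I J} {alpha a1 a2 beta b1 b2 b3 : R -> 'rV[R]_3} :
  open_interval I -> open_interval J ->
  (forall s, I s -> is_derive s 1 alpha (a1 s)) ->
  (forall s, I s -> is_derive s 1 a1 (a2 s)) ->
  (forall s, I s -> lorentz (a1 s) (a1 s) = 1) ->
  (forall s, I s -> 0 < lorentz (a2 s) (a2 s)) ->
  (forall t, J t -> is_derive t 1 beta (b1 t)) ->
  (forall t, J t -> is_derive t 1 b1 (b2 t)) ->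
  (forall t, J t -> is_derive t 1 b2 (b3 t)) ->
  (forall t, J t -> lorentz (b1 t) (b1 t) = 1) ->
  (forall t, J t -> lightlike (b2 t)) ->
  (forall s t, I s -> J t -> lorentz (a1 s) (b1 t) ^+ 2 < 1) ->
  (forall s t, I s -> J t ->
     lorentz (lcross (a1 s) (b1 t)) (a2 s + b2 t) = 0) ->
  exists (e1 e2 e3 p q : 'rV[R]_3) (k m a : R) (x y f : R -> R),
    [/\ orthonormal_frame e1 e2 e3, k != 0 /\ m != 0,
        x = (fun s => lorentz (alpha s) e1) /\
        (forall s, I s -> lorentz (a1 s) e1 != 0),
        (forall s, I s -> alpha s = p + x s *: e1 + y s *: e2) /\
        (forall t, J t ->
          beta t = q + (m * expR (k * t)) *: (e1 + e3) + t *: - e2) &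
        [/\ smooth_on (x @` I) f, forall s, I s -> y s = f (x s) &
          forall z, (x @` I) z ->
            cos (k * z + a) != 0 /\ derive1 f z = - tan (k * z + a)]].
Proof.
move=> oiI oiJ da0 da1 aa a22 db0 db1 db2 bb1 ll ab H.
have [oI iI [s0 Is0]] := oiI; have [oJ iJ [t0 Jt0]] := oiJ.
have a21 s : I s -> lorentz (a2 s) (a1 s) = 0.
  by move=> Is; exact: (lorentz_const_derive1 oI aa Is (da1 s Is)).
have [b [n [k [c [[bb bn nn] [k0 c0] bE eqs]]]]] :=
  exponential_form (ex_intro _ s0 Is0) oiJ aa a21 a22 db1 db2 bb1 ll ab H.
have [e1 [e3 [nu [fr nu0 nE aE]]]] :=
  adapted_frame oiI da1 aa a21 a22 bb bn nn eqs.
have [[e11 e22 e33] [e12 e13 e23]] := fr.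
have uv s : I s -> lorentz (a1 s) e1 ^+ 2 + lorentz (a1 s) (- b) ^+ 2 = 1.
  move=> Is; have [a1E _ _] := aE s Is.
  have := congr1 (lorentz (a1 s)) a1E.
  by rewrite lorentzDr !lorentzZr aa// -!expr2.
have [f [a [sf yf df]]] := profile_of_angle_ode oiI k0
  (fun s Is => is_derive_lorentz e1 (da0 s Is))
  (fun s Is => is_derive_lorentz (- b) (da0 s Is))
  (fun s Is => is_derive_lorentz e1 (da1 s Is))
  (fun s Is => is_derive_lorentz (- b) (da1 s Is))
  (fun s Is => let: And3 _ u0 _ := aE s Is in u0)
  uv
  (fun s Is => let: And3 _ _ ode := aE s Is in ode).
pose x s := lorentz (alpha s) e1; pose y s := lorentz (alpha s) (- b).
pose m := c * nu / k.
pose A s := x s *: e1 + y s *: - b.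
pose B t := (m * expR (k * t)) *: (e1 + e3) + t *: b.
exists e1, (- b), e3, (alpha s0 - A s0), (beta t0 - B t0), k, m, a, x, y, f.
split=> //.
- by split=> //; rewrite !mulf_neq0// invr_neq0.
- by split=> // s Is; have [] := aE s Is.
split.
- move=> s Is; suff <- : alpha s - A s = alpha s0 - A s0.
    by rewrite -addrA subrK.
  apply: (derive0_curve_const (c := fun s => alpha s - A s) iI _ Is Is0).
  move=> t It; have [a1E _ _] := aE t It.
  have := is_deriveB (da0 t It) (is_deriveD
    (is_derive_scaler e1 (is_derive_lorentz e1 (da0 t It)))
    (is_derive_scaler (- b) (is_derive_lorentz (- b) (da0 t It)))).
  by move/is_derive_eq; apply; rewrite -a1E subrr.
- move=> t Jt; suff <- : beta t - B t = beta t0 - B t0.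
    by rewrite opprK -addrA subrK.
  apply: (derive0_curve_const (c := fun t => beta t - B t) iJ _ Jt Jt0).
  move=> s Js.
  have mexp : is_derive s 1 (fun t => m * expR (k * t)) (c * nu * expR (k * s)).
    have kt : is_derive s 1 (fun t : R => k * t) k.
      have := is_deriveZ k (is_derive_id s 1).
      by move/is_derive_eq; apply; exact: mulr1.
    have := is_deriveZ m (@is_derive1_comp _ (@expR R) (fun t => k * t) s _ _
      (is_derive_expR (k * s)) kt).
    move/is_derive_eq; apply; rewrite /m /GRing.scale /=; field.
    exact: k0.
  have := is_deriveB (db0 s Js) (is_deriveD
    (is_derive_scaler (e1 + e3) mexp)
    (is_derive_scaler b (is_derive_id s 1))).
  move/is_derive_eq; apply; rewrite bE// nE scalerA scale1r.
  by rewrite (mulrAC c) [b + _]addrC subrr.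
Qed.

End NormalForm.

Theorem theorem3p1 (R : realType) (I J : set R) (alpha beta : R -> 'rV[R]_3)
  (hI : open_interval I) (hJ : open_interval J)
  (hX : translation_surface I J alpha beta)
  (hS : spacelike_surface (translation_map alpha beta) I J)
  (halpha : spacelike_curve I alpha /\ arc_length I alpha)
  (halpha2 : forall s, I s ->
     spacelike (derive1n 2 alpha s) /\ derive1n 2 alpha s <> 0)
  (hbeta : pseudo_null J beta)
  (hM : maximal_surface (translation_map alpha beta) I J) :
  (planar [set translation_map alpha beta s t | s in I & t in J] \/
   planar (alpha @` I) /\ planar (beta @` J)) /\
  (planar (alpha @` I) /\ planar (beta @` J) ->
   exists (Phi : 'rV[R]_3 -> 'rV[R]_3) (K : set R) (x f : R -> R)
          (a k m theta : R),
     [/\ rigid_motion Phi,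
         open_interval K /\ reparametrization I K x,
         smooth_on K f,
         (k != 0 /\ m != 0) /\
         (forall y, K y ->
            cos (k * (cos theta * f y - y * sin theta) + a) != 0 /\
            derive1 f y = - tan (k * (cos theta * f y - y * sin theta) + a)) &
         forall s t, I s -> J t ->
           Phi (translation_map alpha beta s t) =
           vec3 (x s) (f (x s)) 0 + exp_curve k m theta t]).
Proof.
have [sa sb _] := hX; have [sp_a al_a] := halpha; have [sp_b al_b ll] := hbeta.
have [oI iI _] := hI.
have aa s : I s -> lorentz (derive1 alpha s) (derive1 alpha s) = 1.
  exact: unit_speed.
have bb t : J t -> lorentz (derive1 beta t) (derive1 beta t) = 1.
  exact: unit_speed.
have a22 s : I s -> 0 < lorentz (derive1n 2 alpha s) (derive1n 2 alpha s).
  by move=> /halpha2 [[]].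
have da s : I s -> is_derive s 1 alpha (derive1 alpha s).
  by move=> Is; exact: (smooth_is_derive 0 sa Is).
have db t : J t -> is_derive t 1 beta (derive1 beta t).
  by move=> Jt; exact: (smooth_is_derive 0 sb Jt).
have [e1 [e2 [e3 [p [q [k [m [a [x [y [f]]]]]]]]]]] := normal_form hI hJ da
  (fun s Is => smooth_is_derive 1 sa Is) aa a22
  db (fun t Jt => smooth_is_derive 1 sb Jt)
  (fun t Jt => smooth_is_derive 2 sb Jt) bb ll
  (fun s t => spacelike_angle I J alpha beta aa bb s t hS)
  (fun s t => maximal_det I J alpha beta aa bb s t hM).
move=> [fr [k0 m0] [xE u0] [alphaE betaE] [sf yf df]].
have [[e11 e22 e33] [e12 e13 e23]] := fr.
split.
  right; split.
    apply: (planar_image I alpha p e1 e2 x y) => //.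
    by apply: free_orthogonal; rewrite ?e11 ?oner_neq0// unit_neq0.
  apply: (planar_image J beta q (- e2) (e1 + e3) id
    (fun t => m * expR (k * t))) => [|t Jt]; last first.
    by rewrite betaE// addrAC.
  apply: free_orthogonal.
  - by rewrite !lorentzE opprK e22 oner_neq0.
  - by rewrite !lorentzE (lorentzC e2 e1) e12 e23 ?oppr0 addr0 ?oppr0.
  - apply/eqP => /(congr1 (lorentz e1)).
    by rewrite lorentzDr e11 e13 addr0 /lorentz !mxE !mulr0 addr0 subrr
      => /eqP; rewrite oner_eq0.
move=> _.
have dx s : I s -> is_derive s 1 x (lorentz (derive1 alpha s) e1).
  by rewrite xE => /da; exact: is_derive_lorentz.
exists (fun r => frame_coords e1 e2 e3 r -
  vec3 (lorentz q e1 + lorentz p e1) (lorentz q e2 + lorentz p e2)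
    (- (lorentz q e3 + lorentz p e3))).
(* This angle makes [vec3 (cos theta) (sin theta) 0] the vector [- e2 = b]. *)
exists (x @` I), x, f, a, k, m, (- (pi / 2)).
rewrite cosN sinN cos_pihalf sin_pihalf.
have argE z : k * (0 * f z - z * -1) + a = k * z + a by ring.
split.
- exact: frame_coords_rigid.
- split; first exact: image_open_interval dx u0.
  split.
  + by rewrite xE; exact: smooth_on_lorentz.
  + by move=> s Is; rewrite derive1E; have [_ ->] := dx s Is; exact: u0.
  + split.
    * by move=> s Is; exists s.
    * by move=> s t; rewrite !inE => Is It; exact: inj_of_derive_neq0 iI dx u0 Is It.
    * by move=> z.
- exact: sf.
- by split=> // z Kz; rewrite argE; exact: df.
move=> s t Is Jt; rewrite /translation_map /exp_curve.
rewrite -yf// alphaE// betaE//.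
rewrite cosN sinN cos_pihalf sin_pihalf opprK.
rewrite /frame_coords !lorentzE.
rewrite (lorentzC e2 e1) (lorentzC e3 e1) (lorentzC e3 e2).
rewrite e11 e22 e33 e12 e13 e23.
by apply: rowP3; rewrite !mxE /=; ring.
Qed.
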